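(* If $M$ and $\ell$ are positive integers such that $M\ge 3\ell-1$, then $$\gcd_{\ell\le k\le M-\ell}\binom{M}{k}=\prod_{p}p,$$ where the product runs over all primes $p$ for which there exists an integer $s\ge 1$ with $M-\ell<p^{s}\le M$ (each such prime appearing once). In particular, this gcd is square-free.
   Context: The gcd is taken over the binomial coefficients $\binom{M}{k}$ for all integers $k$ with $\ell\le k\le M-\ell$. *)

(* Defs.v *)
From mathcomp Require Import all_boot.

Set Implicit Arguments.
Unset Strict Implicit.
Unset Printing Implicit Defensive.

(* The bounds p <= M and s <= M only make the search finite; they exclude
   nothing, see mem_power_primes. *)
Definition power_primes (M l : nat) : seq nat :=
  [seq p <- iota 0 M.+1 |
    prime p && [exists s : 'I_M.+1, (1 <= s) && (M - l < p ^ s <= M)]].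

Lemma uniq_power_primes (M l : nat) : uniq (power_primes M l).
Proof. exact/filter_uniq/iota_uniq. Qed.

Lemma mem_power_primes (M l p : nat) :
  p \in power_primes M l <->
  prime p /\ exists s : nat, 1 <= s /\ M - l < p ^ s <= M.
Proof.
rewrite mem_filter mem_iota /= add0n; split.
  by case/andP=> /andP[pr_p /existsP[s /andP[s_gt0 Hs]]] _; split=> //; exists s.
case=> pr_p [s [s_gt0 /andP[Hl Hu]]].
have p_gt1 := prime_gt1 pr_p.
have ltsM : s < M.+1 by rewrite ltnS (leq_trans _ Hu) // ltnW // ltn_expl.
rewrite pr_p /= ltnS; apply/andP; split.
  by apply/existsP; exists (Ordinal ltsM); rewrite /= s_gt0 Hl Hu.
by apply: leq_trans Hu; rewrite -{1}(expn1 p) leq_exp2l.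
Qed.

Definition squarefree (n : nat) : Prop :=
  forall d : nat, d ^ 2 %| n -> d = 1.

(* Main.v *)
Require Import Defs.
From mathcomp Require Import all_boot.
From mathcomp Require Import zify.

(** The exponent of a prime [p] in ['C(M, k)] is the number of carries met when
    [k] and [M - k] are added in base [p] (Kummer, [logn_bin]).  Two consequences
    decide everything.

    If [M - l < p ^ s <= M] and [l <= k <= M - l], then [k] and [M - k] are both
    smaller than [p ^ s] while their sum [M] is not, so a carry reaches position
    [s], and [p] divides every binomial coefficient of the range
    ([dvdn_bin_of_power]).

    Conversely, if [k] is a multiple of [p ^ s], then no carry occurs in the
    lowest [s] positions, so that ['C(M, k)] has [p]-adic valuation at most [t]
    as soon as [M < p ^ (s + t).+1] ([logn_bin_le]).  The range
    [l <= k <= M - l] contains a multiple of every positive [q <= M - l]: either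
    [q] itself, or, when [q < l], one of the at least [l] consecutive integers
    of the range; this is what [3 * l - 1 <= M] is for
    ([exists_multiple_between]).  Let [p ^ s] be the largest power of [p] not
    exceeding [M].  If [p ^ s <= M - l], a multiple of [p ^ s] gives a
    binomial coefficient prime to [p].  In any case a multiple of [p ^ (s - 1)]
    (of [1] when [s = 0]) gives one not divisible by [p ^ 2].
    Hence the gcd is square-free, with the stated prime divisors, and a positive
    square-free number is the product of its prime divisors. *)

Lemma dvdn_biggcd_nat (F : nat -> nat) (d m n : nat) :
  reflect (forall k, m <= k < n -> d %| F k) (d %| \big[gcdn/0]_(m <= k < n) F k).
Proof.
rewrite big_geq_mkord.
apply: (iffP (dvdn_biggcdP _ _ _)) => [dvdF k /andP[le_mk lt_kn] | dvdF i le_mi].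
  exact: (dvdF (Ordinal lt_kn)).
by apply: dvdF; rewrite ltn_ord andbT.
Qed.

Lemma squarefree_from_primes (n : nat) :
  0 < n -> (forall p, prime p -> ~~ (p ^ 2 %| n)) -> squarefree n.
Proof.
move=> n_gt0 nsq d dvd_n; apply/eqP/negPn/negP => d_neq1.
have d_gt0 : 0 < d by move: (dvdn_gt0 n_gt0 dvd_n); rewrite expn_gt0 orbF.
have pr_p : prime (pdiv d) by apply: pdiv_prime; lia.
move/negP: (nsq _ pr_p); apply.
by apply: dvdn_trans dvd_n; rewrite dvdn_exp2r // pdiv_dvd.
Qed.

Lemma prod_primes_squarefree (n : nat) :
  0 < n -> squarefree n -> n = \prod_(p <- primes n) p.
Proof.
move=> n_gt0 sqf.
rewrite {1}(prod_prime_decomp n_gt0) prime_decompE big_map.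
apply: eq_big_seq => p; rewrite -logn_gt0 => logn_pos /=.
have pr_p : prime p by move: logn_pos; rewrite lognE; case: (prime p).
have logn_lt2 : logn p n < 2.
  rewrite ltnNge -pfactor_dvdn //; apply/negP => /sqf p1.
  by rewrite p1 in pr_p.
by have -> : logn p n = 1 by lia.
Qed.

(** Kummer's theorem: the [i]-th summand is the carry into position [i].
    Subtract Legendre's formulas for [k`!] and [(n - k)`!] from the one for
    [n`!] term by term. *)
Lemma logn_bin (p n k : nat) : prime p -> k <= n ->
  logn p 'C(n, k) =
    \sum_(1 <= i < n.+1) (p ^ i <= k %% p ^ i + (n - k) %% p ^ i).
Proof.
move=> pr_p le_kn.
(* Raising the bound in Legendre's formula to a common value only adds zeros. *)
have legendre m : m <= n -> logn p m`! = \sum_(1 <= i < n.+1) m %/ p ^ i.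
  move=> le_mn; rewrite logn_fact // [RHS](@big_cat_nat _ _ _ m.+1) //=.
  rewrite [X in _ = _ + X]big_nat [X in _ = _ + X]big1 ?addn0 // => i /andP[lt_mi _].
  by rewrite divn_small // (ltn_trans lt_mi) // ltn_expl // prime_gt1.
have := congr1 (logn p) (bin_fact le_kn).
rewrite !lognM ?muln_gt0 ?fact_gt0 ?bin_gt0 // !legendre ?leq_subr //.
rewrite -big_split /=.
have -> : \sum_(1 <= i < n.+1) n %/ p ^ i =
    \sum_(1 <= i < n.+1) (p ^ i <= k %% p ^ i + (n - k) %% p ^ i) +
    \sum_(1 <= i < n.+1) (k %/ p ^ i + (n - k) %/ p ^ i).
  rewrite -big_split /=; apply: eq_bigr => i _.
  by rewrite -{1}(subnKC le_kn) divnD ?expn_gt0 ?prime_gt0 // addnC.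
by move/addIn.
Qed.

(** [k] and [n - k] are their own residues modulo [p ^ s], so their sum [n]
    produces a carry into position [s]. *)
Lemma dvdn_bin_of_power (p s n k : nat) : prime p ->
  k < p ^ s -> n - k < p ^ s -> p ^ s <= n -> p %| 'C(n, k).
Proof.
move=> pr_p lt_k lt_nk le_n.
have le_kn : k <= n by lia.
have s_gt0 : 0 < s by case: s lt_k lt_nk le_n => //; rewrite expn0; lia.
have lt_sn : s < n.+1.
  by rewrite ltnS (leq_trans _ le_n) // ltnW // ltn_expl // prime_gt1.
rewrite -(expn1 p) pfactor_dvdn ?bin_gt0 // logn_bin //.
rewrite (bigD1_seq s) ?mem_index_iota ?iota_uniq ?s_gt0 //=.
by rewrite !modn_small // subnKC // le_n.
Qed.

(** Only the positions from [s + 1] to [s + t] can receive a carry: below, the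
    digits of [k] vanish; above, the sum [n] has no digit. *)
Lemma logn_bin_le (p s t n k : nat) : prime p -> k <= n ->
  p ^ s %| k -> n < p ^ (s + t).+1 -> logn p 'C(n, k) <= t.
Proof.
move=> pr_p le_kn dvd_k lt_n; rewrite logn_bin //.
have p_gt0 := prime_gt0 pr_p.
have carry i : (p ^ i <= k %% p ^ i + (n - k) %% p ^ i) <= (s < i <= s + t).
  case: (leqP i s) => [le_is | lt_si] /=.
    have /eqP-> : p ^ i %| k by apply: dvdn_trans dvd_k; rewrite dvdn_exp2l.
    by rewrite add0n [X in nat_of_bool X]leqNgt ltn_pmod // expn_gt0 p_gt0.
  case: (leqP i (s + t)) => [_ | lt_sti]; first exact: leq_b1.
  have lt_ni : n < p ^ i by rewrite (leq_trans lt_n) // leq_pexp2l.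
  have := leq_mod k (p ^ i); have := leq_mod (n - k) (p ^ i).
  by move=> h1 h2; rewrite [X in nat_of_bool X]leqNgt (leq_ltn_trans _ lt_ni) //; lia.
apply: leq_trans (leq_sum _ _) _ => [i _ |]; first exact: carry.
have count m : \sum_(1 <= i < m.+1) (s < i <= s + t) <= minn (m - s) t.
  by elim: m => [|m IHm]; [rewrite big_geq | rewrite big_nat_recr //=; lia].
by apply: leq_trans (count n) _; rewrite geq_minr.
Qed.

Lemma exists_multiple_between (q l u : nat) : 0 < q -> q <= u -> l.*2.-1 <= u ->
  exists k, [/\ q %| k, l <= k & k <= u].
Proof.
move=> q_gt0 le_qu le_lu; case: (ltnP l q) => [lt_lq | le_ql].
  by exists q; split=> //; exact: ltnW.
(* The least multiple of [q] that is at least [l]. *)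
exists ((l + q.-1) %/ q * q).
have := ltn_ceil (l + q.-1) q_gt0; have := leq_divM (l + q.-1) q.
by rewrite mulSn => h1 h2; split; [exact: dvdn_mull | lia | lia].
Qed.

Local Notation central_gcd M l :=
  (\big[gcdn/0]_(l <= k < (M - l).+1) 'C(M, k)).

Lemma central_gcd_dvd (M l k : nat) : l <= k <= M - l -> central_gcd M l %| 'C(M, k).
Proof. by move=> k_range; apply: (dvdn_biggcd_nat _ _ _ _ (dvdnn _)); lia. Qed.

Lemma central_gcd_gt0 (M l : nat) : l.*2 <= M -> 0 < central_gcd M l.
Proof.
move=> le_lM; have : central_gcd M l %| 'C(M, l) by apply: central_gcd_dvd; lia.
by apply: dvdn_gt0; rewrite bin_gt0; lia.
Qed.

(** The range contains a multiple [k] of [p ^ s], and the gcd divides ['C(M, k)].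
    The case [t = 0] identifies the prime divisors of the gcd, the case [t = 1]
    excludes its square factors. *)
Lemma logn_central_gcd_le (M l p s t : nat) : 0 < l -> 3 * l - 1 <= M ->
  prime p -> p ^ s <= M - l -> M < p ^ (s + t).+1 -> logn p (central_gcd M l) <= t.
Proof.
move=> l_gt0 le_lM pr_p le_q lt_M.
have [||k [dvd_k le_lk le_k]] := @exists_multiple_between (p ^ s) l (M - l) _ le_q.
- by rewrite expn_gt0 prime_gt0.
- by lia.
have le_kM : k <= M by lia.
apply: leq_trans (logn_bin_le _ _ _ _ _ pr_p le_kM dvd_k lt_M).
by apply: dvdn_leq_log; rewrite ?bin_gt0 // central_gcd_dvd // le_lk.
Qed.

Lemma central_gcd_nsq (M l p : nat) : 0 < l -> 3 * l - 1 <= M ->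
  prime p -> ~~ (p ^ 2 %| central_gcd M l).
Proof.
move=> l_gt0 le_lM pr_p; have p_gt1 := prime_gt1 pr_p.
rewrite pfactor_dvdn ?central_gcd_gt0 -?ltnNge ?ltnS //; last by lia.
have M_gt0 : 0 < M by lia.
have := trunc_log_bounds p_gt1 M_gt0.
(* One position below the top digit of [M] when [p <= M]; otherwise [M < p]
   and multiples of [p ^ 0] already suffice. *)
case: (trunc_log p M) => [|s] /andP[le_M lt_M].
  apply: (@logn_central_gcd_le _ _ _ 0) => //; first by rewrite expn0; lia.
  by apply: leq_trans lt_M _; rewrite leq_pexp2l // ltnW.
apply: (@logn_central_gcd_le _ _ _ s) => //; last by rewrite addn1.
have : 2 * p ^ s <= M by apply: leq_trans le_M; rewrite expnS leq_mul2r p_gt1 orbT.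
by lia.
Qed.

Lemma primes_central_gcd (M l : nat) : 0 < l -> 3 * l - 1 <= M ->
  primes (central_gcd M l) = power_primes M l.
Proof.
move=> l_gt0 le_lM; have M_gt0 : 0 < M by lia.
apply: (irr_sorted_eq ltn_trans ltnn) => [||p].
- exact: sorted_primes.
- exact: (sorted_filter ltn_trans _ (iota_ltn_sorted _ _)).
apply/idP/idP => [|/mem_power_primes[pr_p [s [_ /andP[gt_q le_q]]]]]; last first.
  rewrite mem_primes pr_p central_gcd_gt0 /=; last by lia.
  apply/dvdn_biggcd_nat => k k_range.
  by apply: (dvdn_bin_of_power _ _ _ _ _ _ _ le_q) => //; lia.
rewrite -logn_gt0 => logn_pos.
have pr_p : prime p by move: logn_pos; rewrite lognE; case: (prime p).
have p_gt1 := prime_gt1 pr_p.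
have /andP[le_q lt_q] := trunc_log_bounds p_gt1 M_gt0.
have gt_q : M - l < p ^ trunc_log p M.
  rewrite ltnNge; apply/negP => le_qMl; move: logn_pos; rewrite ltnNge => /negP; apply.
  by apply: (logn_central_gcd_le _ _ _ _ _ _ _ _ le_qMl) => //; rewrite addn0.
apply/mem_power_primes; split=> //; exists (trunc_log p M); rewrite gt_q le_q; split=> //.
by move: gt_q; case: (trunc_log p M) => //; rewrite expn0; lia.
Qed.

Theorem lemma5p2 (M l : nat) (hM : 0 < M) (hl : 0 < l) (hMl : 3 * l - 1 <= M) :
  \big[gcdn/0]_(l <= k < (M - l).+1) 'C(M, k) = \prod_(p <- power_primes M l) p
  /\ squarefree (\big[gcdn/0]_(l <= k < (M - l).+1) 'C(M, k)).
Proof.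
have G_gt0 : 0 < central_gcd M l by apply: central_gcd_gt0; lia.
have sqf : squarefree (central_gcd M l).
  by apply: squarefree_from_primes => // p; exact: central_gcd_nsq.
split; last exact: sqf.
by rewrite -primes_central_gcd //; exact: prod_primes_squarefree.
Qed.
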